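(* Let $\Phi$ be a field of characteristic zero. The identities $$x(y(zt))\equiv 0$$ and $$x_0(x_1x_4)(x_2x_3)\equiv x_0(x_1x_2)(x_3x_4)+x_0(x_1x_3)(x_2x_4)$$ form a basis of identities of the variety $\widetilde{\mathbf{V}}_3$ of Leibniz algebras over $\Phi$; that is, both hold in $\widetilde{\mathbf{V}}_3$, and every identity that holds in $\widetilde{\mathbf{V}}_3$ is a consequence of these two identities together with the Leibniz identity $(xy)z\equiv (xz)y+x(yz)$.
   Context: A Leibniz algebra over $\Phi$ is a (not necessarily associative) linear algebra with bilinear multiplication satisfying the Leibniz identity $(xy)z\equiv (xz)y+x(yz)$. Brackets are omitted in left-normed products: $abc\cdots d=(((ab)c)\cdots)d$; a bracketed expression such as $(x_1x_4)$ is a single factor in such a product. Let $T=\Phi[t]$ be the polynomial ring in the variable $t$, and let $H$ be the three-dimensional Heisenberg Lie algebra over $\Phi$ with basis $\{a,b,c\}$, multiplication $ba=-ab=c$, and all other products of basis elements zero. $T$ is made into a right $H$-module by $fa=f'$ (the derivative with respect to $t$), $fb=tf$, $fc=f$ for $f\in T$. Let $\widetilde{H}=H\oplus T$ (direct sum of vector spaces) with multiplication $(x+f)(y+g)=xy+fy$ for $x,y\in H$, $f,g\in T$; this is a Leibniz algebra. $\widetilde{\mathbf{V}}_3$ is the variety of Leibniz algebras over $\Phi$ generated by $\widetilde{H}$, i.e. the class of all algebras over $\Phi$ satisfying all identities of $\widetilde{H}$. An identity is a consequence of a set of identities if it holds in every algebra over $\Phi$ satisfying all identities of that set.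
   Formalization: The second identity as printed fails in H̃ (x0=1, x1=x3=a, x2=x4=b gives −1=1); it is replaced by the Plücker relation x0(x1x3)(x2x4) ≡ x0(x1x2)(x3x4)+x0(x1x4)(x2x3), i.e. the monomials x0(x1x4)(x2x3) and x0(x1x3)(x2x4) are interchanged. *)

(* Defs.v *)
From HB Require Import structures.
From mathcomp Require Import all_boot all_order all_algebra.
From mathcomp Require Import ring.

Set Implicit Arguments.
Unset Strict Implicit.
Unset Printing Implicit Defensive.

Import GRing.Theory.
Local Open Scope ring_scope.

Record algebra (F : fieldType) := Algebra {
  carrier :> lmodType F;
  amul : {bilinear carrier -> carrier -> carrier}
}.

(* Non-associative polynomials with coefficients in F, in the variables
   x_0, x_1, ..., presented as terms of the signature of F-algebras. *)
Inductive term (F : fieldType) : Type :=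
| Var of nat
| Zero
| Add of term F & term F
| Scale of F & term F
| Mul of term F & term F.

Arguments Var {F} n.
Arguments Zero {F}.

Declare Scope naterm_scope.
Delimit Scope naterm_scope with term.
Bind Scope naterm_scope with term.
Notation "''x_' i" := (Var i)
  (at level 0, i at level 0, format "''x_' i") : naterm_scope.
Notation "s + t" := (Add s t) : naterm_scope.
Notation "s * t" := (Mul s t) : naterm_scope.

Fixpoint eval (F : fieldType) (A : algebra F) (v : nat -> A) (t : term F) : A :=
  match t with
  | Var i => v i
  | Zero => 0
  | Add s u => eval v s + eval v u
  | Scale k s => k *: eval v s
  | Mul s u => amul A (eval v s) (eval v u)
  end.

Record identity (F : fieldType) := Identity { lhs : term F; rhs : term F }.

Notation "s === t" := (Identity s%term t%term) (at level 70, no associativity).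

Definition satisfies (F : fieldType) (A : algebra F) (e : identity F) : Prop :=
  forall v : nat -> A, eval v (lhs e) = eval v (rhs e).

Definition consequence (F : fieldType) (E : identity F -> Prop)
    (e : identity F) : Prop :=
  forall A : algebra F, (forall s, E s -> satisfies A s) -> satisfies A e.

Definition generated_variety (F : fieldType) (A B : algebra F) : Prop :=
  forall e : identity F, satisfies A e -> satisfies B e.

Definition holds_in (F : fieldType) (V : algebra F -> Prop)
    (e : identity F) : Prop :=
  forall A : algebra F, V A -> satisfies A e.

Definition leibniz_identity (F : fieldType) : identity F :=
  ('x_0 * 'x_1) * 'x_2 === ('x_0 * 'x_2) * 'x_1 + 'x_0 * ('x_1 * 'x_2).

Section Htilde.

Variable F : fieldType.

(* The row vector (p, q, r) stands for p a + q b + r c. *)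
Local Notation heis := 'rV[F]_3.

Definition ia : 'I_3 := 0.
Definition ib : 'I_3 := 1.
Definition ic : 'I_3 := 2%:R.

Definition ha : heis := delta_mx 0 ia.
Definition hb : heis := delta_mx 0 ib.
Definition hc : heis := delta_mx 0 ic.

(* Bilinear extension of ba = -ab = c. *)
Definition heis_mul (x y : heis) : heis :=
  (x 0 ib * y 0 ia - x 0 ia * y 0 ib) *: hc.

(* Extension by linearity in x of fa = f', fb = tf, fc = f. *)
Definition heis_act (f : {poly F}) (x : heis) : {poly F} :=
  x 0 ia *: f^`() + x 0 ib *: ('X * f) + x 0 ic *: f.

Definition Htilde_carrier : lmodType F := (heis * {poly F})%type.

Definition Htilde_mul (u v : Htilde_carrier) : Htilde_carrier :=
  (heis_mul u.1 v.1, heis_act u.2 v.1).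

Lemma Htilde_mul_bilinear : bilinear_for *:%R *:%R Htilde_mul.
Proof.
split=> [v k u w | u k v w]; congr (_, _); rewrite /heis_mul /heis_act /=.
- by rewrite !mxE scalerA -scalerDl; congr (_ *: _); ring.
- rewrite derivD derivZ mulrDr -scalerAr !scalerDr !scalerA.
  rewrite /heis_act ![k * _]mulrC [RHS]addrACA; congr (_ + _).
  by rewrite [RHS]addrACA.
- by rewrite !mxE scalerA -scalerDl; congr (_ *: _); ring.
- rewrite !mxE !scalerDl !scalerDr !scalerA /heis_act [RHS]addrACA.
  by congr (_ + _); rewrite [RHS]addrACA.
Qed.

HB.instance Definition _ :=
  bilinear_isBilinear.Build F Htilde_carrier Htilde_carrier Htilde_carrier
    *:%R *:%R Htilde_mul Htilde_mul_bilinear.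

Definition Htilde : algebra F := @Algebra F Htilde_carrier Htilde_mul.

Lemma heis_mul_basis :
  [/\ heis_mul hb ha = hc, heis_mul ha hb = - hc
    & [/\ heis_mul ha ha = 0, heis_mul hb hb = 0, heis_mul hc hc = 0
        & [/\ heis_mul ha hc = 0, heis_mul hc ha = 0,
              heis_mul hb hc = 0 & heis_mul hc hb = 0]]].
Proof.
by split; last split; last split; rewrite /heis_mul !mxE /=;
  rewrite ?(mulr0, mul0r, mulr1, subr0, sub0r, subrr, oppr0);
  rewrite ?(scale0r, scale1r, scaleN1r).
Qed.

Lemma heis_act_basis (f : {poly F}) :
  [/\ heis_act f ha = f^`(), heis_act f hb = 'X * f & heis_act f hc = f].
Proof.
by split; rewrite /heis_act !mxE /=;
  rewrite !(scale0r, scale1r, addr0, add0r).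
Qed.

Lemma Htilde_leibniz : satisfies Htilde (leibniz_identity F).
Proof.
move=> v /=; move: (v 0%N) (v 1%N) (v 2%N) => [x f] [y g] [z h].
rewrite /Htilde_mul /=; congr (_, _); rewrite /heis_mul /heis_act /=.
  by rewrite !mxE /= -scalerDl; congr (_ *: _); ring.
rewrite !mxE /= !derivD !derivZ derivM derivX -!mul_polyC; ring.
Qed.

(* Writing [ij] for x_i 0 ib * x_j 0 ia - x_i 0 ia * x_j 0 ib, the product
   x_0 (x_i x_j) (x_k x_l) has T-component [ij][kl] f_0, and the brackets
   satisfy the Pluecker relation [13][24] = [12][34] + [14][23].  The relation
   with [13][24] and [14][23] interchanged does not hold: *)
Lemma Htilde_swapped_identity_fails : [pchar F] =i pred0 ->
  ~ satisfies Htilde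
      (('x_0 * ('x_1 * 'x_4)) * ('x_2 * 'x_3) ===
       ('x_0 * ('x_1 * 'x_2)) * ('x_3 * 'x_4) +
       ('x_0 * ('x_1 * 'x_3)) * ('x_2 * 'x_4)).
Proof.
move=> ch0 /(_ (nth 0 [:: (0, 1); (ha, 0); (hb, 0); (ha, 0); (hb, 0)])).
move=> /(congr1 snd) /=; rewrite /heis_act /heis_mul /= !mxE /=.
rewrite !(mulr0, mul0r, mulr1, subrr, subr0, sub0r, scale0r, add0r, addr0,
          scale1r, scaleN1r, oppr0, opprK, scaler0) => H.
have : (2%:R : {poly F}) = 0 by rewrite mulr2n -{1}H addNr.
move/(congr1 (fun p : {poly F} => p`_0)); rewrite -polyC_natr coefC coef0 /=.
by move/eqP; have := ch0 2%N; rewrite inE /= => ->.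
Qed.

End Htilde.

Definition V3tilde (F : fieldType) : algebra F -> Prop :=
  generated_variety (Htilde F).

(* Main.v *)
Require Import Defs.
From mathcomp Require Import all_boot all_order all_algebra.
From mathcomp Require Import zify ring.

(** In an algebra A satisfying the three identities, write R_x for right
    multiplication by x.  The Leibniz identity gives R_(yz) = [R_y, R_z], and
    x(y(zt)) = 0 makes these commutators central.  Hence every element is a
    combination of the products x_i R_M [i1 j1] ... [il jl], where M is a sorted
    list of generators and the last factors are commutators; the second identity
    is the Pluecker relation between them, so the commutators can be
    straightened into a standard tableau with rows i1 <= ... <= il and
    j1 <= ... <= jl, as for the coordinate ring of the Grassmannian Gr(2, n).
    The coefficients of this expansion do not depend on A.

    These standard products are independent on Htilde.  Let R_i act on T by
    p_i D + q_i t + r_i: then the constant term of R_M [i1 j1] ... [il jl]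
    applied to 1 is a polynomial in p, q, r whose leading monomial is
    r_M p_(i1) ... p_(il) q_(j1) ... q_(jl), and this monomial determines the
    standard product.  The Kronecker substitution p_i = s^(B^(3i)),
    q_i = s^(B^(3i+1)), r_i = s^(B^(3i+2)) makes all these constant terms
    univariate polynomials in s with pairwise distinct degrees.  So an identity
    of Htilde has only zero coefficients, and therefore holds in A. *)

Set Implicit Arguments.
Unset Strict Implicit.
Unset Printing Implicit Defensive.

Import GRing.Theory.
Local Open Scope ring_scope.

(** * Right multiplications in models of the three identities *)

Definition nil3_identity (F : fieldType) : identity F :=
  'x_0 * ('x_1 * ('x_2 * 'x_3)) === Zero.

Definition pluecker_identity (F : fieldType) : identity F :=
  ('x_0 * ('x_1 * 'x_3)) * ('x_2 * 'x_4) ===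
  ('x_0 * ('x_1 * 'x_2)) * ('x_3 * 'x_4) +
  ('x_0 * ('x_1 * 'x_4)) * ('x_2 * 'x_3).

Definition basis_model (F : fieldType) (A : algebra F) : Prop :=
  [/\ satisfies A (nil3_identity F), satisfies A (pluecker_identity F)
    & satisfies A (leibniz_identity F)].

Local Notation "x ** y" := (amul _ x y) (at level 40, left associativity).

Section BasisModel.

Variables (F : fieldType) (A : algebra F) (goodA : basis_model A).
Implicit Types x y z t : A.

Lemma mul_leibniz x y z : x ** y ** z = x ** z ** y + x ** (y ** z).
Proof. by have [_ _ /(_ (nth 0 [:: x; y; z]))] := goodA. Qed.

Lemma mul_nil3 x y z t : x ** (y ** (z ** t)) = 0.
Proof. by have [/(_ (nth 0 [:: x; y; z; t]))] := goodA. Qed.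

Lemma mul_pluecker x y z t u :
  x ** (y ** t) ** (z ** u) =
  x ** (y ** z) ** (t ** u) + x ** (y ** u) ** (z ** t).
Proof. by have [_ /(_ (nth 0 [:: x; y; z; t; u]))] := goodA. Qed.

Lemma mul_leibnizr x y z : x ** (y ** z) = x ** y ** z - x ** z ** y.
Proof. by rewrite mul_leibniz addrC addKr. Qed.

Lemma mul_bracketC x y z t : x ** (y ** z) ** t = x ** t ** (y ** z).
Proof. by rewrite [RHS]mul_leibniz mul_nil3 addr0. Qed.

Lemma mul_bracketN x y z : x ** (y ** z) = - (x ** (z ** y)).
Proof. by rewrite !mul_leibnizr opprB. Qed.

Lemma mul_bracket_self x y : x ** (y ** y) = 0.
Proof. by rewrite mul_leibnizr subrr. Qed.

Variable v : nat -> A.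

Definition mulw x (M : seq nat) := foldl (fun y i => y ** v i) x M.
Definition mulb x (P : seq (nat * nat)) :=
  foldl (fun y p => y ** (v p.1 ** v p.2)) x P.

Lemma mulb_letter x i P : mulb x P ** v i = mulb (x ** v i) P.
Proof. by elim: P x => //= p P IH x; rewrite IH mul_bracketC. Qed.

Lemma mulb_bracket x p P :
  mulb x P ** (v p.1 ** v p.2) = mulb (x ** (v p.1 ** v p.2)) P.
Proof. by elim: P x => //= q P IH x; rewrite IH [in LHS]mul_bracketC. Qed.

Lemma mulb_word x M P : mulw (mulb x P) M = mulb (mulw x M) P.
Proof. by elim: M x => //= i M IH x; rewrite mulb_letter IH. Qed.

Lemma mulb_catcons x p P1 P2 : mulb x (P1 ++ p :: P2) = mulb x (p :: P1 ++ P2).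
Proof. by rewrite /mulb !foldl_cat /= -/(mulb _ _) mulb_bracket foldl_cat. Qed.

(** By [mul_bracketC] right multiplications by brackets commute, so only the multiset of bracket
    factors matters. *)
Lemma mulb_perm x P Q : perm_eq P Q -> mulb x P = mulb x Q.
Proof.
elim: P x Q => [|p P IH] x Q; first by move/perm_size/esym/size0nil => ->.
move=> PQ; have /splitPr Q_p: p \in Q by rewrite -(perm_mem PQ) mem_head.
case: Q_p PQ => Q1 Q2.
rewrite mulb_catcons perm_sym (perm_catCA Q1 [:: p]) perm_cons perm_sym.
exact: IH.
Qed.

Lemma mulbD x y P : mulb (x + y) P = mulb x P + mulb y P.
Proof. by elim: P x y => //= p P IH x y; rewrite linearDl IH. Qed.

Lemma mulbN x P : mulb (- x) P = - mulb x P.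
Proof. by elim: P x => //= p P IH x; rewrite linearNl IH. Qed.

Lemma mulb0 P : mulb 0 P = 0.
Proof. by elim: P => //= p P IH; rewrite linear0l IH. Qed.

Lemma mulwD x y M : mulw (x + y) M = mulw x M + mulw y M.
Proof. by elim: M x y => //= p P IH x y; rewrite linearDl IH. Qed.

End BasisModel.

(** * Expansion into words with coefficients common to all models *)

Definition key := (nat * seq nat * seq (nat * nat))%type.

Definition word (F : fieldType) (A : algebra F) (v : nat -> A) (k : key) : A :=
  mulb v (mulw v (v k.1.1) k.1.2) k.2.

Definition comb (F : fieldType) (A : algebra F) (v : nat -> A)
    (l : seq (F * key)) : A :=
  \sum_(c <- l) c.1 *: word v c.2.

(* The coefficients are the same for all models of the identities. *)
Definition expands (F : fieldType) (Q : pred key)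
    (phi : forall A : algebra F, (nat -> A) -> A) : Prop :=
  exists2 l : seq (F * key), all (fun c => Q c.2) l &
    forall (A : algebra F) (v : nat -> A), basis_model A -> phi A v = comb v l.

Section Expands.

Variables (F : fieldType).
Implicit Types (Q : pred key) (phi psi : forall A : algebra F, (nat -> A) -> A).

Lemma expands_ext Q phi psi :
    (forall (A : algebra F) (v : nat -> A), basis_model A ->
      phi A v = psi A v) ->
  expands Q phi -> expands Q psi.
Proof.
by move=> eq_phi [l Ql phiE]; exists l => // A v gA; rewrite -eq_phi ?phiE.
Qed.

Lemma expands_word Q k : Q k -> expands Q (fun (A : algebra F) v => word v k).
Proof.
move=> Qk; exists [:: (1, k)]; first by rewrite /= Qk.
by move=> A v _; rewrite /comb big_seq1 scale1r.
Qed.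

Lemma expands0 Q : expands Q (fun (A : algebra F) v => 0).
Proof. by exists [::] => // A v _; rewrite /comb big_nil. Qed.

Lemma expandsD Q phi psi : expands Q phi -> expands Q psi ->
  expands Q (fun (A : algebra F) v => phi A v + psi A v).
Proof.
move=> [l Ql phiE] [m Qm psiE]; exists (l ++ m); first by rewrite all_cat Ql.
by move=> A v gA; rewrite phiE ?psiE // /comb big_cat.
Qed.

Lemma expandsZ Q a phi : expands Q phi ->
  expands Q (fun (A : algebra F) v => a *: phi A v).
Proof.
move=> [l Ql phiE]; exists [seq (a * c.1, c.2) | c <- l].
  by rewrite all_map.
move=> A v gA; rewrite phiE // /comb scaler_sumr big_map.
by apply: eq_bigr => c _; rewrite scalerA.
Qed.

Lemma expandsN Q phi : expands Q phi ->
  expands Q (fun (A : algebra F) v => - phi A v).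
Proof.
by move/(expandsZ (- 1)); apply: expands_ext => A v _; rewrite scaleN1r.
Qed.

Lemma expandsB Q phi psi : expands Q phi -> expands Q psi ->
  expands Q (fun (A : algebra F) v => phi A v - psi A v).
Proof. by move=> hphi /expandsN; apply: expandsD. Qed.

Lemma expands_sum Q (l : seq (F * key))
    (phi : key -> forall A : algebra F, (nat -> A) -> A) :
    (forall c, c \in l -> expands Q (phi c.2)) ->
  expands Q (fun (A : algebra F) v => \sum_(c <- l) c.1 *: phi c.2 A v).
Proof.
elim: l => [|c l IH] Ql.
  by apply: expands_ext (expands0 _) => A v _; rewrite big_nil.
have Qc : expands Q (phi c.2) by apply: Ql; rewrite mem_head.
have Qd d : d \in l -> expands Q (phi d.2).
  by move=> ld; apply: Ql; rewrite inE ld orbT.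
have := expandsD (expandsZ c.1 Qc) (IH Qd).
by apply: expands_ext => A v _; rewrite big_cons.
Qed.

Lemma expands_trans (Q Q' : pred key) phi : expands Q phi ->
  (forall k, Q k -> expands Q' (fun (A : algebra F) v => word v k)) ->
  expands Q' phi.
Proof.
move=> [l Ql phiE] QQ'.
have : expands Q' (fun (A : algebra F) v => \sum_(c <- l) c.1 *: word v c.2).
  by apply: (expands_sum (phi := fun k A v => word v k)) => c /(allP Ql)/QQ'.
by apply: expands_ext => A v gA; rewrite phiE.
Qed.

Definition is_letter_word : pred key := fun k => k.2 == [::].

Lemma expands_letter phi j : expands is_letter_word phi ->
  expands is_letter_word (fun (A : algebra F) v => phi A v ** v j).
Proof.
move=> [l Ql phiE].
pose psi (k : key) (A : algebra F) v : A := word v k ** v j.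
have : expands is_letter_word
    (fun (A : algebra F) v => \sum_(c <- l) c.1 *: psi c.2 A v).
  apply: expands_sum => -[a [[i M] P]] /(allP Ql)/eqP /= ->.
  apply: expands_ext (expands_word (k := (i, rcons M j, [::])) _) => // A v _.
  by rewrite /psi /word /= /mulw foldl_rcons.
apply: expands_ext => A v gA; rewrite phiE // /comb linear_sumlz.
by apply: eq_bigr => c _; rewrite linearZl_LR.
Qed.

(** Induction on the right factor by u(wn) = (uw)n - (un)w; the last term lengthens the left word,
    so [M] stays general. *)
Lemma expands_mul_words i M j N : expands is_letter_word
  (fun (A : algebra F) v => mulw v (v i) M ** mulw v (v j) N).
Proof.
elim/last_ind: N M => [|N n IH] M.
  apply: expands_ext (expands_word (k := (i, rcons M j, [::])) _) => // A v _.
  by rewrite /word /= /mulw foldl_rcons.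
have := expandsB (expands_letter n (IH M)) (IH (rcons M n)).
apply: expands_ext => A v gA; rewrite /mulw !foldl_rcons -!/(mulw _ _ _).
by rewrite [RHS]mul_leibnizr.
Qed.

Lemma expands_mul phi psi :
    expands is_letter_word phi -> expands is_letter_word psi ->
  expands is_letter_word (fun (A : algebra F) v => phi A v ** psi A v).
Proof.
move=> [l Ql phiE] [m Qm psiE].
pose tau (d c : key) (A : algebra F) v : A := word v c ** word v d.
pose rho d (A : algebra F) v : A := \sum_(c <- l) c.1 *: tau d c.2 A v.
have : expands is_letter_word
    (fun (A : algebra F) v => \sum_(d <- m) d.1 *: rho d.2 A v).
  apply: expands_sum => -[b [[j N] P]] /(allP Qm)/eqP /= ->.
  apply: expands_sum => -[a [[i M] P']] /(allP Ql)/eqP /= ->.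
  exact: expands_mul_words.
apply: expands_ext => A v gA; rewrite phiE ?psiE // /comb linear_sumr.
apply: eq_bigr => d _; rewrite linearZr_LR; congr (_ *: _).
by rewrite linear_sumlz; apply: eq_bigr => c _; rewrite linearZl_LR.
Qed.

Lemma expands_term (t : term F) :
  expands is_letter_word (fun (A : algebra F) v => eval v t).
Proof.
elim: t => [i||t IHt u IHu|a t IHt|t IHt u IHu] /=.
- by apply: expands_ext (expands_word (k := (i, [::], [::])) _).
- exact: expands0.
- exact: expandsD.
- exact: expandsZ.
- exact: expands_mul.
Qed.

(** * Straightening to standard tableaux *)

(* Two-rowed standard tableaux: the rows are [unzip1 P] and [unzip2 P]. *)
Definition standard (P : seq (nat * nat)) : bool :=
  [&& all (fun p => p.1 < p.2)%N P, sorted leq (unzip1 P)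
    & sorted leq (unzip2 P)].

Definition normal : pred key := fun k => sorted leq k.1.2 && standard k.2.

(* Measure for straightening: orienting a pair, or un-nesting two nested pairs
   by the Pluecker relation, makes the total weight drop. *)
Definition pair_weight (p : nat * nat) : nat :=
  ((p.2 - p.1) ^ 2 + 2 * (p.1 - p.2) ^ 2)%N.

Arguments pair_weight : simpl never.

Definition pair_le : rel (nat * nat) :=
  fun p q => (p.1 <= q.1)%N && (p.2 <= q.2)%N.

Lemma pair_weight_leq a b : (a <= b)%N -> pair_weight (a, b) = ((b - a) ^ 2)%N.
Proof. by rewrite /pair_weight /= => /eqP ->; rewrite muln0 addn0. Qed.

Lemma pair_weight_swap a b : (b < a)%N ->
  (pair_weight (b, a) < pair_weight (a, b))%N.
Proof.
move=> lt_ba; rewrite /pair_weight /= (eqP (ltnW lt_ba)) muln0 addn0 add0n.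
by rewrite ltn_Pmull // expn_gt0 subn_gt0 lt_ba.
Qed.

(** In the gaps x = c - a, y = d - c, z = b - d the weight drops by 2xz and by 2(x + y)(y + z)
    respectively. *)
Lemma pair_weight_nested a b c d : (a < c)%N -> (c < d)%N -> (d < b)%N ->
  (pair_weight (a, d) + pair_weight (c, b) <
   pair_weight (a, b) + pair_weight (c, d))%N /\
  (pair_weight (a, c) + pair_weight (d, b) <
   pair_weight (a, b) + pair_weight (c, d))%N.
Proof.
move=> ac cd db.
rewrite !pair_weight_leq -?mulnn; try lia.
have ->: (b - a = (c - a) + (d - c) + (b - d))%N by lia.
have ->: (b - c = (d - c) + (b - d))%N by lia.
have ->: (d - a = (c - a) + (d - c))%N by lia.
have : (0 < c - a)%N by rewrite subn_gt0.
have : (0 < d - c)%N by rewrite subn_gt0.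
have : (0 < b - d)%N by rewrite subn_gt0.
move: (c - a)%N (d - c)%N (b - d)%N => x y z *; split; nia.
Qed.

(** [pair_le] is not total on all pairs, but comparability within [P] lets [sort] produce a chain,
    and both rows of a chain are sorted. *)
Lemma standard_sort P :
    all (fun p => p.1 < p.2)%N P ->
    all2rel (fun p q => pair_le p q || pair_le q p) P ->
  standard (sort pair_le P).
Proof.
move=> oP /allrelP totP; have sP : sorted pair_le (sort pair_le P).
  by apply: (sort_sorted_in totP); apply/allP.
rewrite /standard all_sort oP /= !sorted_map.
by apply/andP; split; apply: sub_sorted sP => p q /andP[].
Qed.

Lemma expands_pairs i M P : sorted leq M ->
  expands normal (fun (A : algebra F) v => word v (i, M, P)).
Proof.
move=> sM; have [n] := ubnP (sumn (map pair_weight P)).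
elim: n => // n IH in P *; rewrite ltnS => leP.
have expP P' : perm_eq P P' ->
      expands normal (fun (A : algebra F) v => word v (i, M, P')) ->
    expands normal (fun (A : algebra F) v => word v (i, M, P)).
  by move=> pP; apply: expands_ext => A v gA;
    rewrite /word (mulb_perm gA _ _ pP).
(* A misoriented pair: [aa] = 0, and [ab] = -[ba] lowers the weight when b < a. *)
have [oP|/allPn[p Pp]] := boolP (all (fun p => p.1 < p.2)%N P); last first.
  rewrite -leqNgt => le_p; have pP := perm_to_rem Pp; apply: (expP _ pP).
  move: leP; rewrite (perm_sumn (perm_map _ pP)).
  case: p {Pp} pP le_p => a b pP /= le_ba.
  rewrite leq_eqVlt in le_ba; case/predU1P: le_ba => [->|lt_ba] leP.
    apply: expands_ext (expands0 _) => A v gA.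
    by rewrite /word /= mul_bracket_self // mulb0.
  have lt_n : (sumn (map pair_weight ((b, a) :: rem (a, b) P)) < n)%N.
    by apply: leq_trans leP; rewrite /= ltn_add2r pair_weight_swap.
  have := expandsN (IH _ lt_n).
  apply: expands_ext => A v gA.
  by rewrite /word /= [in RHS]mul_bracketN // mulbN.
have [tP|/allPn[p Pp]] :=
  boolP (all2rel (fun p q => pair_le p q || pair_le q p) P).
  apply: (expP (sort pair_le P)); first by rewrite perm_sym perm_sort.
  by apply: expands_word; rewrite /normal sM standard_sort.
case/allPn=> q Pq; rewrite negb_or => /andP[npq nqp].
(* For a < c < d < b the Pluecker relation reads [ab][cd] = [ad][cb] - [ac][db], and both terms on
   the right weigh less. *)
have nested a b c d : (a, b) \in P -> (c, d) \in P -> (a < c)%N -> (d < b)%N ->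
    expands normal (fun (A : algebra F) v => word v (i, M, P)).
  move=> Pab Pcd ac db; have cd : (c < d)%N := allP oP _ Pcd.
  have pP := perm_to_rem Pab; set P1 := rem _ _ in pP.
  have P1cd : (c, d) \in P1.
    move: Pcd; rewrite (perm_mem pP) inE => /predU1P[[ca _]|//].
    by rewrite ca ltnn in ac.
  have pP1 := perm_to_rem P1cd; set P2 := rem _ _ in pP1.
  have {}pP : perm_eq P [:: (a, b), (c, d) & P2].
    by apply: perm_trans pP _; rewrite perm_cons.
  apply: (expP _ pP).
  move: leP; rewrite (perm_sumn (perm_map _ pP)) /= => leP.
  have [wt1 wt2] := pair_weight_nested ac cd db.
  have lt1 : (sumn (map pair_weight [:: (a, d), (c, b) & P2]) < n)%N.
    apply: leq_trans leP.
    by rewrite /= addnA (addnA (pair_weight (a, b))) ltn_add2r.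
  have lt2 : (sumn (map pair_weight [:: (a, c), (d, b) & P2]) < n)%N.
    apply: leq_trans leP.
    by rewrite /= addnA (addnA (pair_weight (a, b))) ltn_add2r.
  have := expandsB (IH _ lt1) (IH _ lt2); apply: expands_ext => A v gA.
  by rewrite /word /= mul_pluecker // mulbD [X in X - _]addrC addrK.
(* Oriented pairs that are incomparable are strictly nested, one way or the other. *)
case: p q Pp Pq npq nqp => [a b] [c d] Pab Pcd; rewrite /pair_le /=.
have [ac|ca|_] := ltngtP a c; rewrite /= -?ltnNge ?leqnn //=.
- by move=> db _; apply: nested Pab Pcd ac db.
- by move=> _ bd; apply: nested Pcd Pab ca bd.
- by move=> db; rewrite ltnNge (ltnW db).
Qed.

(** Exchanging adjacent letters a and b costs the bracket (ab), which joins [P]. The correction has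
    two letters fewer, so induction on the length of [M] covers it. *)
Lemma expands_normal k : expands normal (fun (A : algebra F) v => word v k).
Proof.
case: k => [[i M] P]; have [n] := ubnP (size M).
elim: n => // n IH in M P *; rewrite ltnS => leM.
pose equivalent (M1 M2 : seq nat) :=
  expands normal (fun (A : algebra F) v =>
    word v (i, M1, P) - word v (i, M2, P)).
have equiv_refl M1 : equivalent M1 M1.
  by apply: expands_ext (expands0 _) => A v _; rewrite subrr.
have equiv_trans M1 M2 M3 :
    equivalent M1 M2 -> equivalent M2 M3 -> equivalent M1 M3.
  move=> h1 h2; apply: expands_ext (expandsD h1 h2) => A v _.
  by rewrite addrA subrK.
have equiv_swap M1 a b M2 : (size (M1 ++ M2) < n)%N ->
    equivalent (M1 ++ [:: a, b & M2]) (M1 ++ [:: b, a & M2]).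
  move=> ltn; apply: expands_ext (IH _ ((a, b) :: P) ltn) => A v gA.
  rewrite /word /= /mulw !foldl_cat /= -!/(mulw _ _ _).
  rewrite mul_leibniz // mulwD mulbD addrC addKr.
  by rewrite -[LHS]/(mulb _ _ _) (mulb_word gA v _ M2 [:: (a, b)]).
have equiv_move M1 a M2 M3 : (size (M1 ++ M2 ++ M3) < n)%N ->
    equivalent (M1 ++ a :: M2 ++ M3) (M1 ++ M2 ++ a :: M3).
  elim: M2 M1 => [|b M2 IH2] M1 //= ltn.
  apply: equiv_trans (equiv_swap _ _ _ _ _) _.
    by move: ltn; rewrite !size_cat /= size_cat; lia.
  rewrite -!(cat_rcons b); apply: IH2.
  by move: ltn; rewrite !size_cat /= size_rcons !size_cat; lia.
have equiv_perm M1 M2 M3 : (size (M1 ++ M2) <= n)%N -> perm_eq M2 M3 ->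
    equivalent (M1 ++ M2) (M1 ++ M3).
  elim: M2 M1 M3 => [|a M2 IH2] M1 M3 leN.
    by move/perm_size/esym/size0nil => ->.
  move=> M23; have /splitPr M3_a : a \in M3 by rewrite -(perm_mem M23) mem_head.
  case: M3_a M23 => N1 N2.
  rewrite perm_sym (perm_catCA N1 [:: a]) perm_cons perm_sym.
  move=> M2N; apply: equiv_trans (equiv_move M1 a N1 N2 _).
    rewrite -!cat_rcons; apply: IH2 => //.
    by move: leN; rewrite !size_cat size_rcons /=; lia.
  by move: leN (perm_size M2N); rewrite !size_cat /=; lia.
have eqM : equivalent M (sort leq M).
  by apply: (equiv_perm [::]) => //; rewrite perm_sym perm_sort.
apply: expands_ext (expandsD eqM (expands_pairs i P (sort_sorted leq_total M))).
by move=> A v _; rewrite subrK.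
Qed.

Lemma expands_term_normal (t : term F) :
  expands normal (fun (A : algebra F) v => eval v t).
Proof.
by apply: expands_trans (expands_term t) _ => k _; apply: expands_normal.
Qed.

End Expands.

(** * Base-[B] exponents encoding the normal words *)

Section Exponents.

Implicit Types (B : nat) (s t : seq nat).

(** When [size s < B], this integer has the multiplicity of x in [s] as its base-[B] digit in
    position x. *)
Definition digit_sum B s : nat := (\sum_(x <- s) B ^ x)%N.

Lemma digit_sumE B s : digit_sum B s =
  (count_mem 0 s + B * digit_sum B [seq x.-1 | x <- s & 0 < x])%N.
Proof.
rewrite /digit_sum; elim: s => [|[|x] s IH]; first by rewrite !big_nil muln0.
  by rewrite big_cons IH /= expn0 -addnA.
by rewrite !big_cons {}IH /= expnS mulnDr addnCA add0n.
Qed.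

Lemma count_digit B s x : (size s < B)%N ->
  count_mem x s = (digit_sum B s %/ B ^ x %% B)%N.
Proof.
move=> ltB; have B0 : (0 < B)%N by apply: leq_ltn_trans ltB.
elim: x s ltB => [|x IH] s ltB.
  rewrite divn1 digit_sumE addnC mulnC modnMDl modn_small //.
  exact: leq_ltn_trans (count_size _ _) ltB.
rewrite expnS divnMA digit_sumE addnC mulnC divnMDl //.
rewrite (@divn_small (count_mem 0 s)) ?(leq_ltn_trans (count_size _ _)) //.
rewrite addn0 -IH; last first.
  by rewrite size_map size_filter (leq_ltn_trans (count_size _ _)).
rewrite count_map count_filter; apply: eq_count => -[|y];
  by rewrite /= ?andbF ?andbT.
Qed.

Lemma digit_sum_inj B s t : (size s < B)%N -> (size t < B)%N ->
  digit_sum B s = digit_sum B t -> perm_eq s t.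
Proof.
move=> sB tB st; apply/allP => x _.
by rewrite /= !(@count_digit B) // st.
Qed.

(** The factors of the leading monomial: the residue mod 3 is 0 for p, 1 for q and 2 for r, as in
    the Kronecker exponents. *)
Definition code (k : key) : seq nat :=
  [seq 3 * i + 2 | i <- k.1.2] ++ [seq 3 * i | i <- unzip1 k.2]
    ++ [seq 3 * i + 1 | i <- unzip2 k.2].

(** Filtering by residue mod 3 recovers the multisets of [M] and of the two rows; these lists are
    sorted, so the multisets determine them. *)
Lemma code_inj k l : normal k -> normal l -> k.1.1 = l.1.1 ->
  perm_eq (code k) (code l) -> k = l.
Proof.
move: k l => [[i M] P] [[_ N] Q] /and4P[/= sM _ sP1 sP2]
  /and4P[/= sN _ sQ1 sQ2] <- kl.
have filterE r s t u : (r < 3)%N ->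
   [seq x <- [seq 3 * i + 2 | i <- s] ++ [seq 3 * i | i <- t]
    ++ [seq 3 * i + 1 | i <- u] | x %% 3 == r]%N =
  [seq 3 * i + r | i <- nth [::] [:: t; u; s] r]%N.
  move=> r3; rewrite !filter_cat !filter_map.
  have E q v :
      [seq x <- v | preim (fun i => 3 * i + q)%N (fun x => x %% 3 == r)%N x]
      = if (q %% 3 == r)%N then v else [::].
    elim: v => [|x v /= ->]; first by case: ifP.
    by rewrite mulnC modnMDl; case: (_ == r).
  have E0 v :
      [seq x <- v | preim (fun i => 3 * i)%N (fun x => x %% 3 == r)%N x] =
      if (0 == r)%N then v else [::].
    by rewrite -(E 0); apply: eq_filter => x; rewrite /= addn0.
  rewrite !E E0; case: r r3 {E E0} => [|[|[|]]] //= _; rewrite ?cats0 //.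
  by apply: eq_map => x; rewrite addn0.
have lin_inj r : injective (fun i => 3 * i + r)%N by move=> x y; lia.
have permE r : (r < 3)%N ->
    perm_eq (nth [::] [:: unzip1 P; unzip2 P; M] r)
      (nth [::] [:: unzip1 Q; unzip2 Q; N] r).
  move=> r3; have := perm_filter (fun x => x %% 3 == r)%N kl.
  by rewrite /code !filterE //; apply: perm_map_inj.
have eqs s t : sorted leq s -> sorted leq t -> perm_eq s t -> s = t.
  exact: (sorted_eq leq_trans anti_leq).
rewrite (eqs M N sM sN (permE 2 isT)); congr (_, _).
rewrite -(zip_unzip P) -(zip_unzip Q).
by rewrite (eqs _ _ sP1 sQ1 (permE 0 isT)) (eqs _ _ sP2 sQ2 (permE 1 isT)).
Qed.

End Exponents.

(** * One-variable polynomials: distinct degrees and evaluation *)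

Lemma lin_indep_size (F : fieldType) (T : eqType) (U : seq T) (C : T -> F)
    (Q : T -> {poly F}) :
    uniq U -> {in U, forall k, Q k != 0} ->
    {in U &, injective (fun k => size (Q k))} ->
    \sum_(k <- U) C k *: Q k = 0 ->
  {in U, forall k, C k = 0}.
Proof.
(* Descending induction on the degree: at the leading exponent of [Q k], longer polynomials already
   have coefficient zero and shorter ones do not contribute. *)
move=> uU Q0 injQ sum0 k; pose N := \max_(k <- U) size (Q k).
have [n] := ubnP (N - size (Q k)); elim: n => // n IH in k * => lek Uk.
have := congr1 (fun p : {poly F} => p`_(size (Q k)).-1) sum0.
rewrite coef0 coef_sum (bigD1_seq k) //= big1_seq ?addr0 => [|l /andP[lk Ul]].
  rewrite coefZ -/(lead_coef _) => /eqP; rewrite mulf_eq0 lead_coef_eq0.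
  by rewrite (negPf (Q0 _ Uk)) orbF => /eqP.
rewrite coefZ; have [lekl|ltlk|eqkl] := ltngtP (size (Q k)) (size (Q l)).
- rewrite IH ?mul0r //; have : (size (Q l) <= N)%N.
    exact: leq_bigmax_seq Ul _.
  by move: lek; rewrite ltnS; lia.
- rewrite nth_default ?mulr0 //; move: ltlk; case: (size (Q k)) => //.
- by move/eqP: lk; case; apply: injQ.
Qed.

(** Characteristic zero makes the images of the naturals below [size p] distinct: one root too many
    for a nonzero [p]. *)
Lemma poly_horner_eq0 (F : fieldType) (p : {poly F}) :
  [pchar F] =i pred0 -> (forall a, p.[a] = 0) -> p = 0.
Proof.
move=> /pcharf0P natr_eq0 p0.
apply: (@roots_geq_poly_eq0 _ _ [seq i%:R | i <- iota 0 (size p)]).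
- by apply/allP => a _; apply/eqP.
- rewrite map_inj_uniq ?iota_uniq // => m n.
  wlog lemn : m n / (m <= n)%N => [H|/esym/eqP].
    by case/orP: (leq_total m n) => [/H //|/H nm /esym/nm].
  rewrite -subr_eq0 -natrB // natr_eq0 subn_eq0 => lenm.
  by apply/eqP; rewrite eqn_leq lemn.
- by rewrite size_map size_iota.
Qed.

(** * Generic action on T and its leading terms *)

Section Independence.

Variables (F : fieldType) (B : nat).

(* In {poly {poly F}} the inner variable is the Kronecker parameter s and the
   outer one is the variable t of T. *)
Definition gen_p (i : nat) : {poly F} := 'X^(B ^ (3 * i)).
Definition gen_q (i : nat) : {poly F} := 'X^(B ^ (3 * i + 1)).
Definition gen_r (i : nat) : {poly F} := 'X^(B ^ (3 * i + 2)).

Definition gen_act (f : {poly {poly F}}) (i : nat) : {poly {poly F}} :=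
  gen_p i *: f^`() + gen_q i *: ('X * f) + gen_r i *: f.

(** The bracket of two generators is this multiple of c, and c acts on T as the identity. *)
Definition gen_bracket (x : nat * nat) : {poly F} :=
  gen_q x.1 * gen_p x.2 - gen_p x.1 * gen_q x.2.

Definition gen_word (k : key) : {poly {poly F}} :=
  foldl (fun f x => gen_bracket x *: f) (foldl gen_act 1 k.1.2) k.2.

Definition spec_heis (a : F) (i : nat) : 'rV[F]_3 :=
  (gen_p i).[a] *: ha F + (gen_q i).[a] *: hb F + (gen_r i).[a] *: hc F.

(** Only the variable [i0] gets a nonzero T-component, so only words beginning with it keep one. *)
Definition spec_val (a : F) (i0 i : nat) : Htilde F :=
  (spec_heis a i, (i == i0)%:R).

Lemma spec_heisE a i :
  (spec_heis a i 0 ia = (gen_p i).[a]) * (spec_heis a i 0 ib = (gen_q i).[a])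
  * (spec_heis a i 0 ic = (gen_r i).[a]).
Proof. by rewrite /spec_heis !mxE /= !(mulr1, mulr0, add0r, addr0). Qed.

Local Notation spec a := (map_poly (horner_eval a)).

Lemma spec_act a f i :
  heis_act (spec a f) (spec_heis a i) = spec a (gen_act f i).
Proof.
rewrite /heis_act !spec_heisE /gen_act !rmorphD /= deriv_map -!mul_polyC.
by rewrite !rmorphM /= !map_polyC map_polyX.
Qed.

Lemma spec_bracket a f i j :
  heis_act (spec a f) (heis_mul (spec_heis a i) (spec_heis a j)) =
  spec a (gen_bracket (i, j) *: f).
Proof.
rewrite /heis_act /heis_mul !spec_heisE !mxE /= !(mulr0, mulr1, scale0r, add0r).
by rewrite -!mul_polyC rmorphM /= map_polyC /= /horner_eval !hornerE.
Qed.

Lemma spec_word a i0 (k : key) :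
  (word (spec_val a i0) k).2 = if k.1.1 == i0 then spec a (gen_word k) else 0.
Proof.
case: k => [[i M] P]; rewrite /word /gen_word /=.
have actE (y : Htilde F) j f (b : bool) : y.2 = (if b then spec a f else 0) ->
    (y ** spec_val a i0 j).2 = if b then spec a (gen_act f j) else 0.
  move=> /= ->; case: b; rewrite ?spec_act //.
  by rewrite /heis_act deriv0 mulr0 !scaler0 !addr0.
have brE (y : Htilde F) x f (b : bool) : y.2 = (if b then spec a f else 0) ->
    (y ** (spec_val a i0 x.1 ** spec_val a i0 x.2)).2 =
    if b then spec a (gen_bracket x *: f) else 0.
  case: x => j l /= ->; case: b; rewrite ?spec_bracket //.
  by rewrite /heis_act deriv0 mulr0 !scaler0 !addr0.
have : (mulw (spec_val a i0) (spec_val a i0 i) M).2 =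
    if i == i0 then spec a (foldl gen_act 1 M) else 0.
  have : (spec_val a i0 i).2 = if i == i0 then spec a 1 else 0.
    by rewrite /= rmorph1; case: (i == i0).
  elim: M (spec_val a i0 i) 1 => //= j M IH y f yE.
  by apply: IH; apply: actE.
elim: P (mulw _ _ _) (foldl _ _ _) => //= x P IH y f yE.
by apply: IH; apply: brE.
Qed.

Hypothesis B_gt1 : (1 < B)%N.

(** The derivative feeds the coefficient of t into the constant term, so the induction must bound
    every coefficient by the s-degree [d] of the constant term. *)
Definition const_dominant d (f : {poly {poly F}}) :=
  size f`_0 = d.+1 /\ forall j, (size (f`_j)%R <= d.+1)%N.

(** For i < j the exponent of q_i p_j is below 2 B^(3j) <= B^(3j+1), so p_i q_j leads. *)
Lemma size_gen_bracket x : (x.1 < x.2)%N ->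
  size (gen_bracket x) = (B ^ (3 * x.1) + B ^ (3 * x.2 + 1)).+1.
Proof.
move=> ltx; rewrite /gen_bracket -!exprD addrC.
rewrite size_polyDl size_polyN !size_polyXn //.
rewrite ltnS (addn1 (3 * x.2)) expnS.
have lt1 : (B ^ (3 * x.1 + 1) < B ^ (3 * x.2))%N.
  by rewrite ltn_exp2l //; lia.
have : (2 * B ^ (3 * x.2) <= B * B ^ (3 * x.2))%N.
  by rewrite leq_mul2r B_gt1 orbT.
lia.
Qed.

(** r_i has higher degree than p_i and q_i, so [gen_r i *: f] alone sets the degree of the new
    constant term. *)
Lemma const_dominant_act d f i : const_dominant d f ->
  const_dominant (d + B ^ (3 * i + 2)) (gen_act f i).
Proof.
move=> [f0 fj].
have sizeX n (p : {poly F}) :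
    (size p <= d.+1 -> size ('X^n * p)%R <= (d + n).+1)%N.
  move=> lep; rewrite mulrC; have [->|p0] := eqVneq p 0.
    by rewrite mul0r size_poly0.
  by rewrite size_mulXn // addnC -addSn leq_add2r.
have dom m n : (m < n)%N -> (B ^ m < B ^ n)%N by rewrite ltn_exp2l.
have pr : (B ^ (3 * i) < B ^ (3 * i + 2))%N by apply: dom; lia.
have qr : (B ^ (3 * i + 1) < B ^ (3 * i + 2))%N by apply: dom; lia.
have sizeMn (p : {poly F}) n m : (size p <= m -> size (p *+ n)%R <= m)%N.
  by apply: leq_trans; rewrite -scaler_nat size_scale_leq.
have p_le j : (size (gen_p i * (f^`())`_j)%R <= (d + B ^ (3 * i)).+1)%N.
  by apply: sizeX; rewrite coef_deriv sizeMn.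
split=> [|j].
  rewrite /gen_act !coefD !coefZ coefXM /= mulr0 addr0 addrC size_polyDl.
    rewrite mulrC size_mulXn ?f0 ?addnS 1?addnC //.
    by rewrite -size_poly_eq0 f0.
  apply: leq_ltn_trans (p_le 0%N) _.
  rewrite mulrC size_mulXn ?f0; last by rewrite -size_poly_eq0 f0.
  by rewrite addnS ltnS addnC ltn_add2r.
rewrite /gen_act !coefD !coefZ coefXM.
apply: leq_trans (size_polyD _ _) _; rewrite geq_max sizeX // andbT.
apply: leq_trans (size_polyD _ _) _; rewrite geq_max; apply/andP; split.
- by apply: leq_trans (p_le j) _; rewrite ltnS leq_add2l ltnW.
- case: (j == 0%N); first by rewrite mulr0 size_poly0.
  by apply: leq_trans (sizeX _ _ (fj _)) _; rewrite ltnS leq_add2l ltnW.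
Qed.

Lemma size_gen_word k : normal k ->
  size (gen_word k)`_0 = (digit_sum B (code k)).+1.
Proof.
case: k => [[i M] P] /and3P[_ /= ltP _]; rewrite /gen_word /=.
have fold_dominant d f : const_dominant d f ->
    const_dominant (d + \sum_(i <- M) B ^ (3 * i + 2))%N (foldl gen_act f M).
  elim: M d f => [|j M IH] d f fd; first by rewrite big_nil addn0.
  by rewrite big_cons addnA; apply: IH; apply: const_dominant_act.
have [|f0 _] := fold_dominant 0%N 1.
  by split=> [|[|j]]; rewrite coef1 ?size_poly1 ?size_poly0.
rewrite /digit_sum /code !big_cat /= !big_map.
move: f0; rewrite add0n.
elim: P (\sum_(i <- M) _)%N (foldl _ _ _) ltP => [|x P IH] d f /=.
  by rewrite !big_nil !addn0.
case/andP=> ltx ltP f0.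
rewrite (IH (d + (B ^ (3 * x.1) + B ^ (3 * x.2 + 1)))%N) //.
  by rewrite !big_cons -addnA addnACA.
rewrite coefZ size_mul -?size_poly_eq0 ?f0 ?size_gen_bracket //=.
by rewrite addnS /= addnC.
Qed.

Lemma gen_word_neq0 k : normal k -> (gen_word k)`_0 != 0.
Proof. by move/size_gen_word => sz; rewrite -size_poly_eq0 sz. Qed.

End Independence.

(** * Independence on [Htilde] and comparison of expansions *)

Lemma normal_words_independent (F : fieldType) (U : seq key) (C : key -> F) :
    [pchar F] =i pred0 -> uniq U -> all normal U ->
    (forall v : nat -> Htilde F, \sum_(k <- U) C k *: word v k = 0) ->
  {in U, forall k, C k = 0}.
Proof.
move=> char0 uU /allP nU sum0 k0 Uk0.
(* Above every code length, so that digits do not overflow, and at least 2, as the degree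
   computations require. *)
pose B := (\max_(k <- U) size (code k)).+2.
(* [code] does not record the first letter; [spec_val] separates words by it beforehand. *)
pose V := [seq k <- U | k.1.1 == k0.1.1].
have inV k : k \in V -> [/\ k.1.1 = k0.1.1, normal k & (size (code k) < B)%N].
  rewrite mem_filter => /andP[/eqP ik Uk]; split=> //; first exact: nU.
  by rewrite /B ltnS ltnW // ltnS; apply: leq_bigmax_seq Uk _.
apply: (@lin_indep_size _ _ V C (fun k => (gen_word F B k)`_0)).
- exact: filter_uniq.
- by move=> k /inV[_ nk _]; apply: gen_word_neq0.
- move=> k l /inV[ik nk Bk] /inV[il nl Bl].
  rewrite !size_gen_word // => -[/(digit_sum_inj Bk Bl)].
  by apply: code_inj; rewrite ?il.
(* The constant term of the T-component at s = a is the value at a of the combination of Kronecker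
   polynomials. *)
- apply: (poly_horner_eq0 char0) => a.
  have := congr1 (fun x : Htilde F => (x.2 : {poly F})`_0)
    (sum0 (spec_val B a k0.1.1)).
  rewrite -[RHS]/((0 : {poly F})`_0) coef0 => <-.
  have -> (r : seq key) (f : key -> Htilde F) :
      (\sum_(k <- r) f k).2 = \sum_(k <- r) (f k).2.
    by elim/big_rec2: _ => //= k x y _ <-.
  rewrite coef_sum horner_sum big_filter big_mkcond /=; apply: eq_bigr => k _.
  rewrite coefZ spec_word; case: (_ == _); last by rewrite coef0 mulr0.
  by rewrite coef_map /= /horner_eval hornerZ.
- by rewrite mem_filter eqxx.
Qed.

(** A key may occur several times in an expansion; independence applies once its coefficients are
    collected. *)
Lemma comb_undup (F : fieldType) (A : algebra F) (v : nat -> A)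
    (l : seq (F * key)) :
  comb v l = \sum_(k <- undup [seq c.2 | c <- l])
    (\sum_(c <- l | c.2 == k) c.1) *: word v k.
Proof.
under [RHS]eq_bigr do rewrite scaler_suml.
rewrite (exchange_big_dep predT) //= /comb; apply: eq_big_seq => c lc.
under eq_bigl do rewrite eq_sym.
rewrite -big_filter filter_pred1_uniq ?undup_uniq ?big_seq1 //.
by rewrite mem_undup map_f.
Qed.

(** H is nilpotent of class 2 and c acts on T as the identity, which leaves the Pluecker relation
    between 2 by 2 minors of the coordinates along a and b. *)
Lemma Htilde_basis_model (F : fieldType) : basis_model (Htilde F).
Proof.
split; last exact: Htilde_leibniz.
  move=> v /=; rewrite /Htilde_mul /heis_act /heis_mul /= !mxE /=.
  by rewrite !(mulr0, mul0r, subr0, scale0r, addr0).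
move=> v /=; rewrite /Htilde_mul /heis_act /heis_mul /= !mxE /=.
rewrite !(mulr0, mul0r, subr0, scale0r, addr0, add0r, mulr1).
congr (_, _); first by rewrite addr0.
by rewrite !scalerA -scalerDl; congr (_ *: _); ring.
Qed.

Theorem mainTheorem3 (F : fieldType) (char0 : [pchar F] =i pred0) :
  let nil3 : identity F := 'x_0 * ('x_1 * ('x_2 * 'x_3)) === Zero in
  let pluecker : identity F :=
    ('x_0 * ('x_1 * 'x_3)) * ('x_2 * 'x_4) ===
    ('x_0 * ('x_1 * 'x_2)) * ('x_3 * 'x_4) +
    ('x_0 * ('x_1 * 'x_4)) * ('x_2 * 'x_3) in
  [/\ holds_in (@V3tilde F) nil3,
      holds_in (@V3tilde F) pluecker
    & forall e : identity F, holds_in (@V3tilde F) e ->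
        consequence
          (fun s => [\/ s = nil3, s = pluecker | s = leibniz_identity F]) e].
Proof.
move=> nil3 pluecker; have [Hnil3 Hpluecker Hleibniz] := Htilde_basis_model F.
split=> [A|A|e e_holds A A_sat]; [exact| exact|].
have {e_holds} He : satisfies (Htilde F) e by apply: e_holds.
have goodA : basis_model A.
  by split; apply: A_sat; [exact: Or31 | exact: Or32 | exact: Or33].
(* One list [l] expands the difference of the two sides in every model. It vanishes in the model
   [Htilde], so independence kills the collected coefficients, and the difference vanishes in [A]
   too. *)
have [l /allP nl lE] :=
  expandsB (expands_term_normal (lhs e)) (expands_term_normal (rhs e)).
move=> v; apply/eqP; rewrite -subr_eq0 (lE A v goodA) comb_undup.
rewrite big1_seq // => k /andP[_ Uk].
suff -> : \sum_(c <- l | c.2 == k) c.1 = 0 by rewrite scale0r.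
move: k Uk; apply: (normal_words_independent char0 (undup_uniq _)).
  by apply/allP => j; rewrite mem_undup => /mapP[c /nl nc ->].
by move=> w; rewrite -comb_undup -lE ?He ?subrr //; apply: Htilde_basis_model.
Qed.
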